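(* Suppose that $(\mathcal{X},f,\mu)$ is a measure preserving dynamical system which is hyperbolic recurrent, and let $\rho$ be the density of $\mu$. Let $\tau>0$ and put $r_n=\tau/(2n)$. For $x\in\mathcal{X}$ let $X_j(x)=d(f^j x,x)$ and $R_n(r_n,x):=\#\{1\le j\le n:\ X_j(x)\le r_n\}$. Then for all integers $k\ge 0$, $$\lim_{n\to\infty}\mu\left(x\in\mathcal{X}:\ R_n(r_n,x)=k\right)=\int_{\mathcal{X}}\frac{\tau^k\rho(x)^{k+1}}{k!}\,e^{-\rho(x)\tau}\,dx .$$
   Context: Throughout, $\mathcal{X}\subset\mathbb{R}$ is an interval with metric $d(x,y)=|x-y|$, $f:\mathcal{X}\to\mathcal{X}$ is a measurable map, and $\mu$ is an ergodic $f$-invariant Borel probability measure which is absolutely continuous with respect to Lebesgue measure (an acip), with density $\rho$. Norms: $\|\varphi\|_1=\int|\varphi|\,d\mu$, and $\|\varphi\|_{\mathrm{BV}}=\mathrm{var}(\varphi)+\sup|\varphi|$, where $\mathrm{var}(\varphi)$ is the total variation of $\varphi$ on $\mathcal{X}$, i.e. the supremum of $\sum_{i=1}^m|\varphi(x_i)-\varphi(x_{i-1})|$ over finite sequences $x_0<x_1<\dots<x_m$ in $\mathcal{X}$. $\mathrm{BV}$ is the space of functions with $\|\varphi\|_{\mathrm{BV}}<\infty$. (A1) Exponential decay of correlations of $\mathrm{BV}$ against $L^1(\mu)$: there is a rate function $\Theta(j)=C_0e^{-c_0j}$ with $C_0,c_0>0$ such that for all $\varphi_1\in\mathrm{BV}$,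 $\varphi_2\in L^1(\mu)$ and all $j$, $$\left|\int\varphi_1\cdot\varphi_2\circ f^j\,d\mu-\int\varphi_1\,d\mu\int\varphi_2\,d\mu\right|\le\Theta(j)\|\varphi_1\|_{\mathrm{BV}}\|\varphi_2\|_1 .$$ (A2) With $E_j(r):=\{x\in\mathcal{X}: d(x,f^jx)\le r\}$: whenever $r_n\approx n^{-a}$ for some $a>0$ (meaning that the ratio $r_n/n^{-a}$ lies in $[c^{-1},c]$ for a uniform constant $c>1$), there exist $\beta_0\in(0,1)$ and $C>0$ such that $\mu(E_j(r_n))\le C r_n^{\beta_0}$ for all $1\le j\le(\log n)^2$, with $C$ independent of $j$ (and $n$). The system $(\mathcal{X},f,\mu)$ is called hyperbolic recurrent if it satisfies (A1) and (A2) and $\mu$ is ergodic with invariant density $\rho\in\mathrm{BV}$. *)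

(* Defs.v *)
From HB Require Import structures.
From mathcomp Require Import all_boot all_order all_algebra.
From mathcomp Require Import all_classical all_reals all_analysis.

Set Implicit Arguments.
Unset Strict Implicit.
Unset Printing Implicit Defensive.

Import Order.TTheory GRing.Theory Num.Theory.
Import numFieldNormedType.Exports.

Local Open Scope classical_set_scope.
Local Open Scope ring_scope.

(* The phase space is a subset X of R.  Maps and observables on X are total
   functions on R of which only the restriction to X matters, and a measure on
   X is a measure on R giving full mass to X. *)
Section interval_systems.
Context {R : realType}.
Implicit Types (X : set R) (f phi rho : R -> R).
Implicit Type mu : probability (measurableTypeR R) R.

(* a :: s is the finite sequence x_0 < x_1 < ... < x_m, and b is x_m. *)
Definition var_on X phi : \bar R :=
  ereal_sup [set v | exists a b s,
    [/\ X a, forall x, x \in s -> X x, itv_partition a b s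
      & v = (variation a b phi s)%:E]].

Definition sup_norm_on X phi : \bar R :=
  ereal_sup [set `|phi x|%:E | x in X].

Definition bv_norm X phi : \bar R := (var_on X phi + sup_norm_on X phi)%E.

Definition BV_on X phi : Prop := (bv_norm X phi < +oo)%E.

Definition L1_norm X mu phi : \bar R := (\int[mu]_(x in X) `|phi x|%:E)%E.

Definition invariant_measure X f mu : Prop :=
  forall A : set R, measurable A -> mu (X `&` f @^-1` A) = mu A.

Definition ergodic X f mu : Prop :=
  forall A : set R, measurable A -> A `<=` X -> X `&` f @^-1` A = A ->
    mu A = 0%E \/ mu A = 1%E.

Definition density X mu rho : Prop :=
  [/\ measurable_fun X rho,
      forall x, X x -> 0 <= rho x
    & forall A : set R, measurable A -> A `<=` X ->
        mu A = (\int[lebesgue_measure]_(x in A) (rho x)%:E)%E].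

Record acip_system X f mu rho : Prop := AcipSystem {
  acip_interval : is_interval X ;
  acip_maps : forall x, X x -> X (f x) ;
  acip_measurable : measurable_fun X f ;
  acip_full : mu X = 1%E ;
  acip_invariant : invariant_measure X f mu ;
  acip_ergodic : ergodic X f mu ;
  acip_ac : mu `<< lebesgue_measure ;
  acip_density : density X mu rho }.

Definition decay_of_correlations X f mu : Prop :=
  exists C0 c0 : R, [/\ 0 < C0, 0 < c0 &
    forall phi1 phi2 : R -> R,
      BV_on X phi1 -> mu.-integrable X (EFin \o phi2) ->
      forall j : nat,
      (`| \int[mu]_(x in X) (phi1 x * phi2 (iter j f x))%:E
          - (\int[mu]_(x in X) (phi1 x)%:E) * (\int[mu]_(x in X) (phi2 x)%:E) |
        <= (C0 * expR (- c0 * j%:R))%:E * bv_norm X phi1 * L1_norm X mu phi2)%E].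

Definition return_dist f (j : nat) (x : R) : R := `|iter j f x - x|.

Definition return_set X f (j : nat) (r : R) : set R :=
  [set x | X x /\ return_dist f j x <= r].

(* Restricted to n >= 1, where n^(-a) is positive. *)
Definition comparable_power (r : nat -> R) (a : R) : Prop :=
  exists2 c : R, 1 < c &
    forall n : nat, (0 < n)%N -> c^-1 <= r n / n%:R `^ (- a) <= c.

Definition short_returns X f mu : Prop :=
  forall (r : nat -> R) (a : R), 0 < a -> comparable_power r a ->
  exists beta0 C : R, [/\ 0 < beta0 < 1, 0 < C &
    forall n j : nat, (0 < n)%N -> (1 <= j)%N -> j%:R <= (ln n%:R) ^+ 2 :> R ->
      (mu (return_set X f j (r n)) <= (C * r n `^ beta0)%:E)%E].

Record hyperbolic_recurrent X f mu rho : Prop := HyperbolicRecurrent {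
  hr_acip : acip_system X f mu rho ;
  hr_decay : decay_of_correlations X f mu ;
  hr_short_returns : short_returns X f mu ;
  hr_density_BV : BV_on X rho }.

Definition return_count f (n : nat) (r : R) (x : R) : nat :=
  count (fun j => return_dist f j x <= r) (index_iota 1 n.+1).

End interval_systems.

(* Main.v *)
Require Import Defs.
From mathcomp Require Import all_boot all_order all_algebra.
From mathcomp Require Import all_classical all_reals all_analysis.
From mathcomp Require Import measurable_realfun ring lra.
Import Order.TTheory GRing.Theory Num.Theory.
Import numFieldNormedType.Exports.
Local Open Scope classical_set_scope.
Local Open Scope ring_scope.

Set Implicit Arguments.
Unset Strict Implicit.
Unset Printing Implicit Defensive.

(** The orbit of [x] returns when it hits the ball of radius [r = tau / (2 n)]
    around [x], whose mass is about [tau rho(x) / n].  In [n] steps there are thus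
    about [tau rho(x)] returns; mixing makes their number Poisson, and averaging the
    Poisson weight over [x] against [mu = rho dx] gives the limit.  Two obstacles
    stand in the way: the target moves with [x], and decay of correlations decouples
    a function of bounded variation in the present from an arbitrary event in the
    future, so that only single intervals may be decoupled, not intersections of
    events along the orbit.

    _A fixed target._  Let [J] be an interval, [q = mu(J)], and [p_m(k)] the
    probability that an orbit visits [J] exactly [k] times during [m] steps.  By
    invariance, adding one time at the start of the orbit gives
      [p_(m+1)(k) = p_m(k) - mu(J, k later visits) + mu(J, k - 1 later visits)].
    Forgetting the first [L] later steps costs a quick return to [J] and [L q^2];
    the interval [J] is then decoupled from the rest, so that up to these errors
      [p_(m+1)(k) = p_m(k) + q (p_m(k - 1) - p_m(k))].
    This is Euler's scheme for the differential equation of the Poisson weights,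
    whence [p_m(k)] is close to the Poisson weight of parameter [m q]
    ([pr_visits_poisson]).  Neither moments nor inclusion-exclusion occur.

    _The moving target._  Cut [[-n, n[] into cells of length [w = n^-2], much shorter
    than [r].  For [x] in the cell with left end [a], the ball around [x] is replaced
    with the ball around [a]: this matters only for visits to an annulus of mass
    [O(w)].  The cell is an interval, so it can be decoupled from the future, where
    the target is now fixed ([cell_poisson]).  There are [2 n^3] cells, which is
    harmless because a waiting time [L = (ln n)^2] makes the correlations
    superpolynomially small.  A quick return to the ball around [a] is a point that
    comes back within [2 r] of itself in at most [L] steps, an event of mass
    [O(L r^beta)]; as every point lies in balls belonging to cells of total mass
    [O(r)], summing over the cells gains the factor [r] that compensates for the [n]
    steps ([nreturns_poisson], [cvg_nreturns_poisson]).

    _The limit._  At a Lebesgue point, [n] times the mass of the ball tends to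
    [tau rho(x)] ([cvg_pr_window]), and dominated convergence concludes. *)

(** * Poisson weights *)

Section poisson_weights.
Context {R : realType}.
Implicit Types (s t q : R) (k : nat).

(** At parameter 0, which occurs where the density vanishes, this is the unit mass
    at [k = 0]. *)
Definition pois k s : R := s ^+ k / k`!%:R * expR (- s).

Definition prev (u : nat -> R) k : R := if k is k'.+1 then u k' else 0.

Lemma pois_ge0 k s : 0 <= s -> 0 <= pois k s.
Proof. by move=> s0; rewrite mulr_ge0 ?expR_ge0// divr_ge0// exprn_ge0. Qed.

Lemma pois_le1 k s : 0 <= s -> pois k s <= 1.
Proof.
move=> s0; rewrite /pois expRN ler_pdivrMr ?expR_gt0// mul1r.
case: k => [|k]; first by rewrite expr0 fact0 divr1 (le_trans _ (expR_ge1Dx s))// lerDl.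
by apply: le_trans (expR_ge1Dxn k s0); rewrite lerDr.
Qed.

Lemma pois_at0 k : pois k 0 = (k == 0)%:R.
Proof.
by rewrite /pois oppr0 expR0 mulr1 expr0n; case: k => [|k]; rewrite ?fact0 ?divr1 ?mul0r.
Qed.

(** The weights solve the linear equation [u_k' = u_(k-1) - u_k], which is what a
    counter that is incremented at rate 1 obeys. *)
Lemma is_derive_pois k s :
  is_derive s 1 (pois k) (prev (pois^~ s) k - pois k s).
Proof.
have dE : is_derive s 1 (fun x : R => expR (- x)) (- expR (- s)).
  by apply: is_derive_eq; rewrite /GRing.scale/=; ring.
have dP : is_derive s 1 (fun x : R => x ^+ k) (k%:R * s ^+ k.-1).
  have /= := @is_deriveX R R id k s 1 1 (is_derive_id s 1).
  rewrite (_ : id ^+ k = fun x : R => x ^+ k) ?[_ *: _]mulr1//.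
  by apply/funext => x; rewrite fctE.
have h := is_deriveZ k`!%:R^-1 (is_deriveM dP dE).
have hE : pois k =
    k`!%:R^-1 \*: ((fun x : R => x ^+ k) * (fun x : R => expR (- x))).
  by apply/funext => x; rewrite /pois mulrAC mulrC.
rewrite -hE in h; apply: (is_derive_eq h).
rewrite /GRing.scale/= /prev; case: k {dP h hE} => [|k]; rewrite /pois/=.
  by rewrite expr0 fact0; field.
rewrite factS natrM; field.
by rewrite -(natrD _ 1) !pnatr_eq0 -lt0n fact_gt0.
Qed.

Lemma prev_pois_itv k s : 0 <= s -> 0 <= prev (pois^~ s) k <= 1.
Proof.
by move=> s0; case: k => [|k] /=; rewrite ?lexx ?ler01// pois_ge0// pois_le1.
Qed.

Lemma pois_mvt k s t : 0 <= s -> s <= t -> exists2 c, s <= c <= t &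
  pois k t - pois k s = (prev (pois^~ c) k - pois k c) * (t - s).
Proof.
move=> s0 st; have [|c cst ->] := @MVT_segment _ (pois k)
    (fun c => prev (pois^~ c) k - pois k c) _ _ st (fun x _ => is_derive_pois k x).
  apply: derivable_within_continuous => x _.
  by have [] := is_derive_pois k x.
by exists c => //; move: cst; rewrite in_itv.
Qed.

(** The derivative is the difference of two numbers of [[0, 1]]. *)
Lemma pois_lip k s t : 0 <= s -> 0 <= t -> `|pois k s - pois k t| <= `|s - t|.
Proof.
wlog st : s t / s <= t.
  move=> h s0 t0; have [st|/ltW ts] := leP s t; first exact: h.
  by rewrite distrC [leRHS]distrC; exact: h.
move=> s0 t0; rewrite distrC [leRHS]distrC.
have [c /andP[sc ct] ->] := pois_mvt k s0 st.
have c0 := le_trans s0 sc.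
rewrite normrM ler_piMl//.
have /andP[? ?] := prev_pois_itv k c0.
have := pois_ge0 k c0; have := pois_le1 k c0.
by rewrite ler_norml => ? ?; apply/andP; split; lra.
Qed.

Lemma prev_pois_lip k s t : 0 <= s -> 0 <= t ->
  `|prev (pois^~ s) k - prev (pois^~ t) k| <= `|s - t|.
Proof.
by case: k => [|k] s0 t0 /=; rewrite ?subrr ?normr0//; exact: pois_lip.
Qed.

(** Local error of Euler's scheme: by the mean value theorem the increment is the
    derivative at an intermediate point, and the derivative is 2-Lipschitz. *)
Lemma pois_step k s q : 0 <= s -> 0 <= q ->
  `|pois k (s + q) - (pois k s + q * (prev (pois^~ s) k - pois k s))| <= 2 * q ^+ 2.
Proof.
move=> s0 q0; have [|c /andP[sc csq]] := @pois_mvt k s (s + q) s0.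
  by rewrite lerDl.
rewrite [X in _ * X](_ : _ = q); last by ring.
move=> /eqP; rewrite subr_eq => /eqP ->.
have c0 := le_trans s0 sc.
have := pois_lip k c0 s0; have := prev_pois_lip k c0 s0.
set u := prev _ _; set v := prev _ _; set a := pois _ _; set b := pois _ _.
move=> h1 h2.
rewrite (_ : _ - _ = q * ((u - v) - (a - b))); last by ring.
rewrite normrM ger0_norm// expr2 mulrCA ler_wpM2l//.
apply: le_trans (ler_normB _ _) _.
have : `|c - s| <= q by rewrite ger0_norm ?subr_ge0// lerBlDr addrC.
lra.
Qed.

(** Global error of Euler's scheme.  For [0 <= q <= 1] one step is a convex
    combination of [p m k] and [p m (k - 1)], hence does not amplify the errors made
    before: these simply add up. *)
Lemma pois_approx (p : nat -> nat -> R) q err : 0 <= q <= 1 ->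
  (forall k, p 0%N k = (k == 0)%:R) ->
  (forall m k, `|p m.+1 k - (p m k + q * (prev (p m) k - p m k))| <= err) ->
  forall m k, `|p m k - pois k (m%:R * q)| <= m%:R * (err + 2 * q ^+ 2).
Proof.
move=> /andP[q0 q1] p0 pS; elim=> [|m IH] k.
  by rewrite !mul0r p0 pois_at0 subrr normr0.
have IH' : `|prev (p m) k - prev (pois^~ (m%:R * q)) k| <= m%:R * (err + 2 * q ^+ 2).
  case: k => [|k] /=; last exact: IH.
  by rewrite subrr normr0; exact: le_trans (normr_ge0 _) (IH 0%N).
have := pois_step k (mulr_ge0 (ler0n R m) q0) q0.
rewrite -[m.+1]addn1 natrD !(mulrDl m%:R) !mul1r.
move: (IH k) (pS m k); rewrite -[m.+1]addn1.
set a := p _ _; set b := p _ _; set s := m%:R * q; set M := m%:R * (err + _) in IH' *.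
set u := prev _ _ in IH' *; set v := prev _ _ in IH' *.
set x := pois _ _; set y := pois _ _ => h1 h2 h3.
rewrite (_ : b - y = (b - (a + q * (u - a))) - (y - (x + q * (v - x)))
  + ((1 - q) * (a - x) + q * (u - v))); last by ring.
apply: le_trans (ler_normD _ _) _.
rewrite addrC lerD//; last exact: le_trans (ler_normB _ _) (lerD h2 h3).
apply: le_trans (ler_normD _ _) _; rewrite !normrM (ger0_norm q0).
have q1' : 0 <= 1 - q by rewrite subr_ge0.
rewrite (ger0_norm q1').
have := ler_wpM2l q1' h1; have := ler_wpM2l q0 IH'; lra.
Qed.
End poisson_weights.

(** * Visits to a fixed target *)

Section probability_of_events.
Context d (T : measurableType d) (R : realType) (mu : probability T R).
Implicit Types A B E : set T.

(** Measures of events are handled as real numbers, where subtraction is available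
    without side conditions. *)
Definition pr A : R := fine (mu A).

Lemma prE A : measurable A -> mu A = (pr A)%:E.
Proof. by move=> mA; rewrite /pr fineK// fin_num_measure. Qed.

Lemma pr_ge0 A : 0 <= pr A.
Proof. by rewrite fine_ge0. Qed.

Lemma pr_le1 A : measurable A -> pr A <= 1.
Proof. by move=> mA; rewrite -lee_fin -prE// probability_le1. Qed.

Lemma le_pr A B : measurable A -> measurable B -> A `<=` B -> pr A <= pr B.
Proof. by move=> mA mB AB; rewrite -lee_fin -!prE// le_measure ?inE. Qed.

Lemma prU_le A B : measurable A -> measurable B -> pr (A `|` B) <= pr A + pr B.
Proof.
move=> mA mB; rewrite -lee_fin EFinD -!prE//; last exact: measurableU.
exact: measureU2.
Qed.

Lemma pr_disjointU A B : measurable A -> measurable B -> A `&` B = set0 ->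
  pr (A `|` B) = pr A + pr B.
Proof.
move=> mA mB AB; apply: EFin_inj; rewrite EFinD -!prE//; last exact: measurableU.
by rewrite measureU.
Qed.

Lemma prIC A B : measurable A -> measurable B ->
  pr (~` A `&` B) = pr B - pr (A `&` B).
Proof.
move=> mA mB; apply/eqP; rewrite eq_sym subr_eq; apply/eqP.
rewrite -pr_disjointU; first by rewrite -setIUl setUC setUv setTI.
- exact/measurableI/mB/measurableC.
- exact: measurableI.
- by rewrite setIACA setICl set0I.
Qed.

Lemma pr_bigsetU_le n (F : nat -> set T) : (forall i, (i < n)%N -> measurable (F i)) ->
  pr (\big[setU/set0]_(i < n) F i) <= \sum_(i < n) pr (F i).
Proof.
elim: n => [|n IH] mF; first by rewrite !big_ord0 /pr measure0.
rewrite !big_ord_recr/=.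
have mB : measurable (\big[setU/set0]_(i < n) F i).
  by apply: bigsetU_measurable => i _; apply: mF; rewrite ltnW// ltnS.
apply: le_trans (prU_le mB (mF _ _)) _ => //.
by rewrite lerD2r; apply: IH => i ni; apply: mF; rewrite ltnW.
Qed.

Lemma pr_dist A B E : measurable A -> measurable B -> measurable E ->
  A `<=` B `|` E -> B `<=` A `|` E -> `|pr A - pr B| <= pr E.
Proof.
move=> mA mB mE AB BA; rewrite ler_distlC lerBlDr; apply/andP; split.
  exact: le_trans (le_pr mA (measurableU _ _ mB mE) AB) (prU_le mB mE).
exact: le_trans (le_pr mB (measurableU _ _ mA mE) BA) (prU_le mA mE).
Qed.

End probability_of_events.

Lemma measurable_count d (T : measurableType d) (B : nat -> set T) m k :
  (forall i, (i < m)%N -> measurable (B i)) ->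
  measurable [set x | (\sum_(i < m) (x \in B i))%N = k].
Proof.
elim: m k => [|m IH] k mB.
  have [k0|k0] := pselect (0%N = k).
    by rewrite (_ : mkset _ = setT)//; apply/seteqP; split => x //=; rewrite big_ord0.
  by rewrite (_ : mkset _ = set0)//; apply/seteqP; split => x //=; rewrite big_ord0.
have {}IH k' : measurable [set x | (\sum_(i < m) (x \in B i))%N = k'].
  by apply: IH => i im; apply: mB; rewrite ltnW.
have mBm : measurable (B m) by exact: mB.
have -> : [set x | (\sum_(i < m.+1) (x \in B i))%N = k] =
   (~` B m `&` [set x | (\sum_(i < m) (x \in B i))%N = k]) `|`
   (B m `&` [set x | ((\sum_(i < m) (x \in B i)).+1)%N = k]).
  apply/seteqP; split => x /=; rewrite big_ord_recr/=.
    have [xB|xB] := pselect (B m x).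
      by rewrite (mem_set xB) addn1; right.
    by rewrite (memNset xB) addn0; left.
  by case=> -[xB]; rewrite ?(mem_set xB) ?(memNset xB) ?addn1 ?addn0.
apply: measurableU; apply: measurableI; [exact: measurableC|exact: IH|exact: mBm|].
case: k => [|k].
  by rewrite (_ : mkset _ = set0)//; apply/seteqP; split => x.
rewrite (_ : mkset _ = [set x | (\sum_(i < m) (x \in B i))%N = k])//.
by apply/seteqP; split => x /=; [case|move=> ->].
Qed.

(** An initial stretch of length [L] where nothing is counted can be dropped; the
    truncated subtraction makes this true also when [m < L]. *)
Lemma count_skip (b b' : nat -> bool) L m :
  (forall i, (i < L)%N -> b i = false) ->
  (forall i, (L <= i < m)%N -> b i = b' (i - L)%N) ->
  (\sum_(i < m) b i = \sum_(i < m - L) b' i)%N.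
Proof.
move=> b0 bb'; rewrite -!(big_mkord xpredT (fun i => nat_of_bool (_ i))).
have [mL|/ltnW Lm] := leqP m L.
  rewrite (eqP mL) [RHS]big_geq// big_nat big1// => i /andP[_ im].
  by rewrite b0// (leq_trans im).
rewrite (@big_cat_nat _ _ _ L)//= big_nat big1 ?add0n; last first.
  by move=> i /andP[_ iL]; rewrite b0.
rewrite -{1}[L]add0n big_addn big_nat [RHS]big_nat; apply: eq_bigr => i /andP[_ im].
by rewrite bb' ?addnK// leq_addl/= addnC -ltn_subRL.
Qed.

Section visits.
Context d (T : measurableType d) (R : realType) (mu : probability T R).
Variable g : T -> T.
Hypothesis mg : measurable_fun setT g.
Hypothesis g_inv : forall A, measurable A -> mu (g @^-1` A) = mu A.
Implicit Types A J : set T.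
Local Notation P := (pr mu).

Lemma measurable_preimage_iter j A : measurable A -> measurable (iter j g @^-1` A).
Proof.
move=> mA; elim: j => // j IH.
rewrite (_ : _ @^-1` _ = g @^-1` (iter j g @^-1` A)).
  by rewrite -[X in measurable X]setTI; exact: mg.
by apply/seteqP; split => x; rewrite /= -iterS iterSr.
Qed.

Lemma pr_preimage_iter j A : measurable A -> P (iter j g @^-1` A) = P A.
Proof.
move=> mA; elim: j => // j IH.
rewrite (_ : _ @^-1` _ = g @^-1` (iter j g @^-1` A)); last first.
  by apply/seteqP; split => x; rewrite /= -iterS iterSr.
by rewrite -IH /pr g_inv//; exact: measurable_preimage_iter.
Qed.

Definition visits J m x : nat := (\sum_(i < m) (x \in iter i g @^-1` J))%N.

Lemma visitsS J m x : visits J m.+1 x = ((x \in J) + visits J m (g x))%N.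
Proof.
rewrite /visits big_ord_recl; congr addn; apply: eq_bigr => i _.
by congr nat_of_bool; apply/idP/idP; rewrite !inE /= -iterSr.
Qed.

Lemma visits_skip J L m x : (forall i, (i < L)%N -> ~ J (iter i g x)) ->
  visits J m x = visits J (m - L) (iter L g x).
Proof.
move=> xJ; apply: (count_skip (b := fun i => x \in iter i g @^-1` J)
  (b' := fun i => iter L g x \in iter i g @^-1` J)); move=> i.
  by move=> /xJ ?; rewrite memNset.
move=> /andP[Li _].
by apply/idP/idP; rewrite !inE/= -iterD subnK.
Qed.

Lemma measurable_visits J m k : measurable J -> measurable [set x | visits J m x = k].
Proof.
move=> mJ; apply: (measurable_count (B := fun i => iter i g @^-1` J)) => i _.
exact: measurable_preimage_iter.
Qed.

Definition visited J L : set T := \big[setU/set0]_(i < L) (iter i g @^-1` J).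

Lemma measurable_visited J L : measurable J -> measurable (visited J L).
Proof.
by move=> mJ; apply: bigsetU_measurable => i _; exact: measurable_preimage_iter.
Qed.

Lemma visitedP J L x : visited J L x <-> exists2 i, (i < L)%N & J (iter i g x).
Proof.
rewrite /visited -(bigcup_mkord L (fun i => iter i g @^-1` J));
  split; first by case=> i /= iL ?; exists i.
by case=> i iL ?; exists i.
Qed.

Lemma visits_skip_visited J L m x : ~ visited J L x ->
  visits J m x = visits J (m - L) (iter L g x).
Proof.
move=> nx; apply: visits_skip => i iL Jx; apply: nx.
by apply/visitedP; exists i.
Qed.

Lemma pr_visited J L : measurable J -> P (visited J L) <= L%:R * P J.
Proof.
move=> mJ; apply: le_trans (pr_bigsetU_le mu (F := fun i => iter i g @^-1` J) _) _.
  by move=> i _; exact: measurable_preimage_iter.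
rewrite (eq_bigr (fun=> P J)); last by move=> i _; exact: pr_preimage_iter.
by rewrite sumr_const card_ord mulr_natl.
Qed.

Lemma pr_visits_skip J L m k : measurable J ->
  `|P [set x | visits J m x = k] - P [set x | visits J (m - L) x = k]| <= L%:R * P J.
Proof.
move=> mJ; rewrite -(pr_preimage_iter L (measurable_visits (m - L) k mJ)).
apply: le_trans (pr_visited L mJ); apply: pr_dist.
- exact: measurable_visits.
- exact/measurable_preimage_iter/measurable_visits.
- exact: measurable_visited.
- move=> x /= xk; have [|/visits_skip_visited] := pselect (visited J L x); first by right.
  by move=> <-; left.
- move=> x /= xk; have [|/visits_skip_visited E] := pselect (visited J L x); first by right.
  by left; rewrite E.
Qed.

Section poisson_visits.
Variables (J : set T) (L : nat) (theta e : R).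
Hypothesis mJ : measurable J.
Hypothesis decorrelation : forall A, measurable A ->
  `|P (J `&` iter L.+1 g @^-1` A) - P J * P A| <= theta.
Hypothesis short_return : P (J `&` g @^-1` visited J L) <= e.

Let err := e + theta + L%:R * P J ^+ 2.

(** Start in [J] and look at the number of later visits.  The first [L] later times are
    forgotten, the rest is decoupled from [J], and the forgotten times are put back:
    the three terms of [err] in the order of [e], [theta], [L q^2]. *)
Let decouple m k : `|P (J `&` g @^-1` [set x | visits J m x = k]) -
  P J * P [set x | visits J m x = k]| <= err.
Proof.
have mV m' : measurable [set x | visits J m' x = k] by exact: measurable_visits.
have mg1 A : measurable A -> measurable (g @^-1` A).
  exact: (measurable_preimage_iter 1).
have h1 : `|P (J `&` g @^-1` [set x | visits J m x = k]) -
    P (J `&` iter L.+1 g @^-1` [set x | visits J (m - L) x = k])| <= e.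
  apply: le_trans short_return; apply: pr_dist.
  - by apply: measurableI => //; exact: mg1.
  - by apply: measurableI => //; exact: measurable_preimage_iter.
  - by apply: measurableI => //; apply: mg1; exact: measurable_visited.
  - move=> x [Jx /= xk].
    have [|/visits_skip_visited E] := pselect (visited J L (g x)); first by right.
    by left; split => //=; rewrite -iterS iterSr -E.
  - move=> x [Jx]; rewrite /= -iterS iterSr => xk.
    have [|/visits_skip_visited E] := pselect (visited J L (g x)); first by right.
    by left; split => //=; rewrite E.
have h2 := decorrelation (mV (m - L)%N).
have h3 := pr_visits_skip L m k mJ.
move: h1 h2 h3; set a := P (J `&` _); set b := P (J `&` _).
set c := P [set x | _]; set c' := P [set x | _] => h1 h2 h3.
have h4 : `|P J * c - P J * c'| <= L%:R * P J ^+ 2.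
  rewrite distrC -mulrBr normrM (ger0_norm (pr_ge0 _ _)) expr2 mulrCA.
  by rewrite ler_wpM2l ?pr_ge0.
rewrite (_ : _ - _ = (a - b) + (b - P J * c) + (P J * c - P J * c')); last by ring.
by rewrite /err !(le_trans (ler_normD _ _))// !lerD// !(le_trans (ler_normD _ _))// !lerD.
Qed.

(** The induction adds a time at the start of the orbit and not at its end: the event
    in the present is then [J] itself, and everything else is in the future. *)
Lemma pr_visits_poisson m k :
  `|P [set x | visits J m x = k] - pois k (m%:R * P J)| <=
    m%:R * (2 * err + 2 * P J ^+ 2).
Proof.
have mV m' k' : measurable [set x | visits J m' x = k'] by exact: measurable_visits.
have mg1 A : measurable A -> measurable (g @^-1` A).
  exact: (measurable_preimage_iter 1).
apply: (pois_approx (p := fun m k => P [set x | visits J m x = k])).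
- by rewrite pr_ge0 pr_le1.
- move=> {}k; case: k => [|k].
    rewrite (_ : mkset _ = setT); first by rewrite /pr probability_setT.
    by apply/seteqP; split => x //=; rewrite /visits big_ord0.
  rewrite (_ : mkset _ = set0); first by rewrite /pr measure0.
  by apply/seteqP; split => x //=; rewrite /visits big_ord0.
move=> {}m {}k.
pose V k' := [set x | visits J m x = k'].
have -> : P [set x | visits J m.+1 x = k] =
    P (~` J `&` g @^-1` V k) + prev (fun k' => P (J `&` g @^-1` V k')) k.
  case: k => [|k] /=.
    rewrite addr0; congr P; apply/seteqP; split => x /=; rewrite visitsS /V/=.
      have [Jx|Jx] := pselect (J x); first by rewrite (mem_set Jx).
      by rewrite (memNset Jx).
    by move=> [Jx]; rewrite (memNset Jx).
  rewrite -pr_disjointU; last 3 first.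
  - by apply: measurableI; [exact: measurableC|exact/mg1/mV].
  - by apply: measurableI => //; exact/mg1/mV.
  - by apply/seteqP; split => x // [[? _] []].
  congr P; apply/seteqP; split => x /=; rewrite visitsS /V/=.
    have [Jx|Jx] := pselect (J x); first by rewrite (mem_set Jx) add1n => -[<-]; right.
    by rewrite (memNset Jx) => ?; left.
  by case=> -[Jx]; [rewrite (memNset Jx)|rewrite (mem_set Jx) => ->].
rewrite prIC//; last exact/mg1/mV.
rewrite (pr_preimage_iter 1); last exact: mV.
have := decouple m k; have : `|prev (fun k' => P (J `&` g @^-1` V k')) k -
    P J * prev (fun k' => P (V k')) k| <= err.
  case: k => [|k] /=; last exact: decouple.
  rewrite mulr0 subrr normr0; exact: le_trans (normr_ge0 _) (decouple 0 0).
rewrite -/(V k); set a := prev _ _; set b := prev _ _; set c := P (V k).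
set a' := P (_ `&` _) => h1 h2.
rewrite (_ : _ - _ = (a - P J * b) - (a' - P J * c)); last by ring.
by rewrite mulr_natl mulr2n (le_trans (ler_normB _ _))// lerD.
Qed.

End poisson_visits.
End visits.

(** * Integrals over cells *)

Section weighted_integrals.
Context d (T : measurableType d) (R : realType) (mu : probability T R).
Local Notation P := (pr mu).

Lemma integrable_pr (h : T -> R) A c : measurable A -> measurable_fun setT h ->
  (forall x, 0 <= h x <= c) -> mu.-integrable A (EFin \o h).
Proof.
move=> mA mh h01; apply: (le_integrable mA (g := cst c%:E)).
- exact/measurable_EFinP/measurable_funTS.
- move=> x _ /=; rewrite lee_fin; have /andP[? ?] := h01 x.
  by rewrite !ger0_norm// (@le_trans _ _ (h x)).
- exact: finite_measure_integrable_cst.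
Qed.

Lemma Rintegral_cst_near (h : T -> R) A c b : measurable A ->
  mu.-integrable A (EFin \o h) -> (forall x, A x -> `|c - h x| <= b) ->
  `|P A * c - \int[mu]_(x in A) h x| <= P A * b.
Proof.
move=> mA ih hc.
have ic c' : mu.-integrable A (EFin \o cst c').
  exact: finite_measure_integrable_cst.
rewrite ler_distlC -mulrDr -mulrBr ![P A * _]mulrC /pr -!(Rintegral_cst mu mA).
by apply/andP; split; (apply: le_Rintegral => //; [exact: ic|]) => x /hc;
  rewrite ler_distlC /= => /andP[].
Qed.

(** Exchanging sum and integral: the left side is the integral over [E] of the total
    weight of the sets that contain the point. *)
Lemma sum_pr_overlap N (c : nat -> R) (J : nat -> set T) (E : set T) K :
  measurable E -> (forall i, measurable (J i)) -> (forall i, 0 <= c i) ->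
  (forall y, \sum_(i < N) c i * (y \in J i)%:R <= K) ->
  \sum_(i < N) c i * P (J i `&` E) <= K * P E.
Proof.
move=> mE mJ c0 cK.
rewrite -lee_fin EFinM -prE// -sumEFin.
rewrite (eq_bigr (fun i : 'I_N => \int[mu]_(y in E) ((c i)%:E * (\1_(J i) y)%:E)))%E.
  rewrite -ge0_integral_sum//; last 2 first.
  - by move=> i; apply/measurable_EFinP/measurable_funM => //; exact: measurable_indic.
  - by move=> i x _; rewrite mule_ge0// lee_fin.
  rewrite -integral_cst//; apply: ge0_le_integral => //.
  - by move=> x _; apply: sume_ge0 => i _; rewrite mule_ge0// lee_fin.
  - by apply: emeasurable_sum => i; apply/measurable_EFinP/measurable_funM => //;
      exact: measurable_indic.
  - by move=> x _; under eq_bigr do rewrite -EFinM; rewrite sumEFin lee_fin; exact: cK.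
move=> i _; rewrite ge0_integralZl//; last 2 first.
- by apply/measurable_EFinP; exact: measurable_indic.
- by rewrite lee_fin.
by rewrite integral_indic// EFinM -prE//; exact: measurableI.
Qed.

End weighted_integrals.

(** * Returns of points of small cells *)

Section returns_in_cells.
Context (R : realType) (mu : probability (measurableTypeR R) R) (g : R -> R).
Hypothesis mg : measurable_fun setT g.
Hypothesis g_inv : forall A, measurable A -> mu (g @^-1` A) = mu A.
Local Notation P := (pr mu).

Variables (D : R) (L : nat) (theta : R).
Hypothesis D_ge0 : 0 <= D.
Hypothesis pr_itv : forall a b, a <= b -> P `[a, b] <= D * (b - a).
Hypothesis theta_ge0 : 0 <= theta.
Hypothesis decorrelation : forall (I : set R) j A, is_interval I -> (L < j)%N ->
  measurable A -> `|P (I `&` iter j g @^-1` A) - P I * P A| <= theta.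

Definition window (r x : R) : set R := `[x - r, x + r]%classic.
Definition cell (w a : R) : set R := `[a, a + w[%classic.
Definition annulus (r w a : R) : set R :=
  `[a - r - w, a - r + w]%classic `|` `[a + r - w, a + r + w]%classic.
Definition returns j (s : R) : set R := [set x | `|iter j g x - x| <= s].
Definition nreturns (r : R) n x : nat := (\sum_(i < n) (x \in returns i.+1 r))%N.
Definition returned (r : R) m : set R := \big[setU/set0]_(i < m) returns i.+1 r.

Lemma measurable_returns j s : measurable (returns j s).
Proof.
have mj : measurable_fun setT (fun x : R => `|iter j g x - x|).
  apply/measurableT_comp => //; apply: measurable_funB => //.
  by move=> _ A mA; rewrite setTI; exact: measurable_preimage_iter.
rewrite (_ : returns j s = (fun x : R => `|iter j g x - x|) @^-1` `]-oo, s]).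
  by rewrite -[X in measurable X]setTI; exact: mj.
by apply/seteqP; split => x /=; rewrite /returns/= in_itv.
Qed.

Lemma measurable_nreturns r n k : measurable [set x | nreturns r n x = k].
Proof.
apply: (measurable_count (B := fun i => returns i.+1 r)) => i _.
exact: measurable_returns.
Qed.

Lemma measurable_returned r m : measurable (returned r m).
Proof. by apply: bigsetU_measurable => i _; exact: measurable_returns. Qed.

Lemma returnedP r m x : returned r m x <-> exists2 i, (i < m)%N & returns i.+1 r x.
Proof.
rewrite /returned -(bigcup_mkord m (fun i => returns i.+1 r)).
by split; case=> i im ?; exists i.
Qed.

Lemma measurable_annulus r w a : measurable (annulus r w a).
Proof. by apply: measurableU; exact: measurable_itv. Qed.

Lemma pr_window r a : 0 <= r -> P (window r a) <= 2 * r * D.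
Proof. by move=> r0; apply: le_trans (pr_itv _) _; lra. Qed.

Lemma pr_annulus r w a : 0 <= w -> P (annulus r w a) <= 4 * w * D.
Proof.
move=> w0; apply: le_trans (prU_le _ _ _) _; [exact: measurable_itv..|].
apply: le_trans (lerD (pr_itv _) (pr_itv _)) _; lra.
Qed.

(** The balls of radius [r] around two points at distance at most [w] differ only at
    points whose distance to either centre is within [w] of [r]. *)
Lemma window_corner r w a x y : `|x - a| <= w -> ~ annulus r w a y ->
  (`|y - x| <= r) = (y \in window r a).
Proof.
rewrite ler_distl => /andP[x1 x2] ya.
have y1 : ~ (a - r - w <= y <= a - r + w).
  by move=> h; apply: ya; left; rewrite /= in_itv.
have y2 : ~ (a + r - w <= y <= a + r + w).
  by move=> h; apply: ya; right; rewrite /= in_itv.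
rewrite ler_distl; apply/idP/idP; rewrite inE /window/= in_itv/= => /andP[h1 h2].
  have [y3|y3] := leP (a - r) y => /=.
    have [//|y4] := leP y (a + r).
    by exfalso; apply: y2; apply/andP; split; lra.
  by exfalso; apply: y1; apply/andP; split; lra.
have [y3|y3] := leP (x - r) y => /=.
  have [//|y4] := leP y (x + r).
  by exfalso; apply: y2; apply/andP; split; lra.
by exfalso; apply: y1; apply/andP; split; lra.
Qed.

Lemma pr_window_near r w x a : 0 <= w -> `|x - a| <= w ->
  `|P (window r a) - P (window r x)| <= 4 * w * D.
Proof.
move=> w0 xa; apply: le_trans (pr_annulus r a w0).
have E y : ~ annulus r w a y -> window r x y = window r a y.
  move=> ya; apply/propext; rewrite [window r x]/window/= in_itv/= -ler_distl.
  by rewrite (window_corner xa ya) inE.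
apply: pr_dist; [exact: measurable_itv|exact: measurable_itv|exact: measurable_annulus|..];
  by move=> y yw; have [|/E yE] := pselect (annulus r w a y); [right|left; move: yw; rewrite yE].
Qed.

Lemma measurable_pois_window r n k :
  measurable_fun setT (fun x => pois k (n%:R * P (window r x))).
Proof.
apply: continuous_measurable_fun => x.
apply/cvgrPdist_le => /= eps eps0.
have D1 : 0 < n%:R * (4 * D) + 1 by rewrite ltr_wpDl// mulr_ge0// mulr_ge0.
near=> y.
have P0 z : 0 <= n%:R * P (window r z) by rewrite mulr_ge0 ?pr_ge0.
apply: le_trans (pois_lip k (P0 _) (P0 _)) _.
rewrite -mulrBr normrM ger0_norm//.
apply: (@le_trans _ _ (n%:R * (4 * `|y - x| * D))).
  by rewrite ler_wpM2l// pr_window_near.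
apply: (@le_trans _ _ ((n%:R * (4 * D) + 1) * `|x - y|)).
  by rewrite distrC; have := normr_ge0 (x - y); nra.
rewrite mulrC -ler_pdivlMr//.
near: y; apply: cvgr_dist_le; first exact: cvg_id.
by rewrite divr_gt0.
Unshelve. all: by end_near. Qed.

Section one_cell.
Variables (r w a e : R) (n k : nat).
Hypothesis (r_ge0 : 0 <= r) (w_ge0 : 0 <= w).
Let I := cell w a.
Let J := window r a.
Let W := annulus r w a.
Hypothesis short_return : P (J `&` g @^-1` visited g J L) <= e.
Let h x := pois k (n%:R * P (window r x)).
Let V := [set x | visits g J (n - L) x = k].

Let mI : measurable I. Proof. exact: measurable_itv. Qed.
Let mJ : measurable J. Proof. exact: measurable_itv. Qed.
Let mV : measurable V. Proof. exact: measurable_visits. Qed.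

Let IJ x : I x -> `|x - a| <= w.
Proof. by rewrite /I /cell/= in_itv/= ler_norml => /andP[? ?]; apply/andP; split; lra. Qed.

(** Up to returns until time [L] and visits to the annulus, the returns of a point of
    the cell are the visits of its orbit, from time [L + 1] on, to the fixed window. *)
Let returns_visits : `|P (I `&` [set x | nreturns r n x = k]) -
  P (I `&` iter L.+1 g @^-1` V)| <=
  P (I `&` returned r L) + n%:R * (P I * (4 * w * D) + theta).
Proof.
pose F j := I `&` iter (L + j).+1 g @^-1` W.
have mF j : measurable (F j).
  by apply: measurableI => //; apply: measurable_preimage_iter => //; exact: measurable_annulus.
have mR : measurable (I `&` returned r L).
  by apply: measurableI => //; exact: measurable_returned.
have mFs : measurable (\big[setU/set0]_(j < n - L) F j) by exact: bigsetU_measurable.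
apply: (@le_trans _ _ (P ((I `&` returned r L) `|` \big[setU/set0]_(j < n - L) F j))).
  have key x : I x -> ~ ((I `&` returned r L) `|` \big[setU/set0]_(j < n - L) F j) x ->
      nreturns r n x = visits g J (n - L) (iter L.+1 g x).
    move=> Ix nx; apply: (count_skip (b := fun i => x \in returns i.+1 r)
        (b' := fun i => iter L.+1 g x \in iter i g @^-1` J)) => i.
      move=> iL; apply: memNset => xi; apply: nx; left; split => //.
      by apply/returnedP; exists i.
    move=> /andP[Li im].
    have Wx : ~ W (iter i.+1 g x).
      move=> Wx; apply: nx; right; rewrite -(bigcup_mkord _ F).
      by exists (i - L)%N; rewrite /= ?ltn_sub2r ?(leq_ltn_trans Li)// /F subnKC.
    have -> : (x \in returns i.+1 r) = (`|iter i.+1 g x - x| <= r).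
      by apply/idP/idP; rewrite inE.
    rewrite (window_corner (IJ Ix) Wx).
    have -> : iter i.+1 g x = iter (i - L) g (iter L.+1 g x).
      by rewrite -iterD addnS subnK.
    by apply/idP/idP; rewrite !inE.
  apply: pr_dist.
  - by apply: measurableI => //; exact: measurable_nreturns.
  - by apply: measurableI => //; exact: measurable_preimage_iter.
  - exact: measurableU.
  - move=> x [Ix /= xk].
    by have [|/(key _ Ix) E] := pselect (((I `&` returned r L) `|`
      \big[setU/set0]_(j < n - L) F j) x); [right|left; split; rewrite //= /V/= -E].
  - move=> x [Ix /= xk].
    by have [|/(key _ Ix) E] := pselect (((I `&` returned r L) `|`
      \big[setU/set0]_(j < n - L) F j) x); [right|left; split; rewrite //= E].
apply: le_trans (prU_le mu mR mFs) _; rewrite lerD2l.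
apply: le_trans (pr_bigsetU_le mu (F := F) _) _; first by move=> j _; exact: mF.
apply: (@le_trans _ _ (\sum_(j < n - L) (P I * (4 * w * D) + theta))).
  apply: ler_sum => j _.
  have : `|P (F j) - P I * P W| <= theta.
    apply: decorrelation; [exact: interval_is_interval| |exact: measurable_annulus].
    by rewrite ltnS leq_addr.
  rewrite ler_distl => /andP[_ h1]; apply: le_trans h1 _.
  by rewrite lerD2r ler_wpM2l ?pr_ge0// pr_annulus.
rewrite sumr_const card_ord -[leLHS]mulr_natl ler_wpM2r//.
  by rewrite addr_ge0// !mulr_ge0// pr_ge0.
by rewrite ler_nat leq_subr.
Qed.

(** The chain of approximations for one cell: returns are replaced with visits to the
    window of the corner; the cell is decoupled from these visits; the [L] missing
    times are restored; the number of visits is Poisson; finally the mass of the window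
    of the corner is replaced with that of the window of the point. *)
Lemma cell_poisson :
  `|P (I `&` [set x | nreturns r n x = k]) - \int[mu]_(x in I) h x| <=
    P (I `&` returned r L) + n.+1%:R * theta + P I * (8 * n%:R * w * D
    + 2 * L%:R * r * D + n%:R * (2 * (e + theta + L%:R * (2 * r * D) ^+ 2) + 2 * (2 * r * D) ^+ 2)).
Proof.
have PI0 : 0 <= P I by exact: pr_ge0.
have PI1 : P I <= 1 by exact: pr_le1.
have PJ : P J <= 2 * r * D by exact: pr_window.
have PJ0 : 0 <= P J by exact: pr_ge0.
have PJ2 : P J ^+ 2 <= (2 * r * D) ^+ 2 by rewrite lerXn2r// nnegrE (le_trans PJ0).
have h1 := returns_visits.
have h2 : `|P (I `&` iter L.+1 g @^-1` V) - P I * P V| <= theta.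
  by apply: decorrelation => //; exact: interval_is_interval.
have h3 : `|P [set x | visits g J n x = k] - P V| <= L%:R * (2 * r * D).
  by apply: le_trans (pr_visits_skip (mu := mu) mg g_inv L n k mJ) _; rewrite ler_wpM2l.
have h4 : `|P [set x | visits g J n x = k] - pois k (n%:R * P J)| <=
    n%:R * (2 * (e + theta + L%:R * (2 * r * D) ^+ 2) + 2 * (2 * r * D) ^+ 2).
  apply: (@le_trans _ _ (n%:R * (2 * (e + theta + L%:R * P J ^+ 2) + 2 * P J ^+ 2))).
    apply: pr_visits_poisson => // A mA.
    by apply: decorrelation => //; exact: interval_is_interval.
  by rewrite ler_wpM2l// lerD// ler_wpM2l// lerD2l ler_wpM2l.
have h5 : `|P I * pois k (n%:R * P J) - \int[mu]_(x in I) h x| <=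
    P I * (n%:R * (4 * w * D)).
  apply: Rintegral_cst_near => //.
    apply: (@integrable_pr _ _ _ mu h I 1) => //; first exact: measurable_pois_window.
    by move=> x; rewrite pois_ge0 ?pois_le1// mulr_ge0// pr_ge0.
  move=> x Ix; apply: le_trans (pois_lip _ _ _) _; rewrite ?mulr_ge0 ?pr_ge0//.
  rewrite -mulrBr normrM ger0_norm// ler_wpM2l// pr_window_near//; exact: IJ.
move: h1 h2 h3 h4 h5.
set S := P (I `&` returned r L); set B := P (I `&` iter L.+1 g @^-1` V).
set A := P (I `&` [set x | nreturns r n x = k]).
set v := P V; set p := P [set x | visits g J n x = k]; set q := pois k (n%:R * P J).
set E4 := n%:R * (2 * _ + _); set H := Rintegral _ _ _ => h1 h2 h3 h4 h5.
have h34 : `|P I * v - P I * q| <= P I * (L%:R * (2 * r * D) + E4).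
  rewrite -mulrBr normrM (ger0_norm PI0) ler_wpM2l//.
  rewrite (_ : v - q = (p - q) - (p - v)); last by ring.
  by apply: le_trans (ler_normB _ _) _; rewrite addrC lerD.
rewrite (_ : A - H = (A - B) + (B - P I * v) + (P I * v - P I * q) + (P I * q - H));
  last by ring.
apply: le_trans (ler_normD _ _) _.
apply: le_trans (lerD (le_trans (ler_normD _ _) (lerD (le_trans (ler_normD _ _)
  (lerD h1 h2)) h34)) h5) _.
rewrite -natr1; lra.
Qed.

End one_cell.
Section all_cells.
Variables (r w b : R) (N n k : nat).
Hypothesis (r_ge0 : 0 <= r) (w_ge0 : 0 <= w).
Let h x := pois k (n%:R * P (window r x)).
Let corner (i : nat) := b + i%:R * w.
Let U m := `[b, corner m[%classic.
Let cellE i : cell w (corner i) = `[corner i, corner i.+1[%classic.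
Proof. by rewrite /cell /corner -natr1 mulrDl mul1r addrA. Qed.

Let US m : U m.+1 = U m `|` cell w (corner m).
Proof.
rewrite cellE /U; apply: itv_bndbnd_setU; rewrite bnd_simp.
  by rewrite /corner lerDl mulr_ge0.
by rewrite /corner lerD2l ler_wpM2r// ler_nat.
Qed.

Let Udisj m : U m `&` cell w (corner m) = set0.
Proof.
apply/seteqP; split => // x []; rewrite /U /cell/= !in_itv/= => /andP[_ h1] /andP[h2 _].
by move: h1; rewrite ltNge h2.
Qed.

Let U0 : U 0 = set0.
Proof.
apply/seteqP; split => // x; rewrite /U/= in_itv/= /corner mul0r addr0 => /andP[h1].
by rewrite ltNge h1.
Qed.

Let mcell i : measurable (cell w (corner i)). Proof. exact: measurable_itv. Qed.
Let mU m : measurable (U m). Proof. exact: measurable_itv. Qed.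

Let pr_cells B : measurable B ->
  \sum_(i < N) P (cell w (corner i) `&` B) = P (U N `&` B).
Proof.
move=> mB; elim: N => [|m IH]; first by rewrite big_ord0 U0 set0I /pr measure0.
rewrite big_ord_recr/= IH US setIUl pr_disjointU; last 3 first.
- exact: (measurableI _ _ (mU m) mB).
- exact: (measurableI _ _ (mcell m) mB).
- by rewrite setIACA Udisj set0I.
by [].
Qed.

Let ih A : measurable A -> mu.-integrable A (EFin \o h).
Proof.
move=> mA; apply: (@integrable_pr _ _ _ mu h A 1) => //; first exact: measurable_pois_window.
by move=> x; rewrite pois_ge0 ?pois_le1// mulr_ge0// pr_ge0.
Qed.

Let Rintegral_cells :
  \sum_(i < N) \int[mu]_(x in cell w (corner i)) h x = \int[mu]_(x in U N) h x.
Proof.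
elim: N => [|m IH]; first by rewrite big_ord0 U0 Rintegral_set0.
rewrite big_ord_recr/= IH US (@Rintegral_setU _ _ _ mu _ _ _ (mU m) (mcell m))//.
  by apply: ih; exact: (measurableU _ _ (mU m) (mcell m)).
by apply/disj_setPS; rewrite Udisj.
Qed.

(** A point [y] lies in the window of a cell only if the cell lies in
    [[y - r, y + r + w]], an interval of small mass; the cells being disjoint, this
    bounds the total mass of the cells whose windows contain [y]. *)
Let overlap E : measurable E ->
  \sum_(i < N) P (cell w (corner i)) * P (window r (corner i) `&` E) <=
    (2 * r + w) * D * P E.
Proof.
move=> mE.
suff cover (y : R) : \sum_(i < N) P (cell w (corner i)) *
    (y \in window r (corner i))%:R <= (2 * r + w) * D.
  apply: (@sum_pr_overlap _ _ _ mu N (fun i => P (cell w (corner i)))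
    (fun i => window r (corner i))) => //.
  - by move=> i; exact: measurable_itv.
  - by move=> i; exact: pr_ge0.
pose K : set R := `[y - r, y + r + w]%classic.
have mK : measurable K by exact: measurable_itv.
apply: (@le_trans _ _ (\sum_(i < N) P (cell w (corner i) `&` K))).
  apply: ler_sum => i _.
  have [yi|yi] := pselect (window r (corner i) y); last first.
    by rewrite memNset// mulr0 pr_ge0.
  rewrite mem_set// mulr1; apply: le_pr; [exact: mcell|exact: (measurableI _ _ (mcell i) mK)|].
  move=> x xi; split => //; move: yi xi; rewrite /K /window /cell/= !in_itv/=.
  by move=> /andP[? ?] /andP[? ?]; apply/andP; split; lra.
rewrite pr_cells//.
apply: (@le_trans _ _ (P K)); first by apply: le_pr => //; exact: (measurableI _ _ (mU N) mK).
have [r0 w0] := (r_ge0, w_ge0); apply: le_trans (pr_itv _) _; lra.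
Qed.

(** Two visits to the same window are at distance at most [2 r]. *)
Let short_return i : P (window r (corner i) `&` g @^-1` visited g (window r (corner i)) L)
  <= P (window r (corner i) `&` returned (2 * r) L).
Proof.
have mJ : measurable (window r (corner i)) by exact: measurable_itv.
apply: le_pr.
- apply: measurableI => //; apply: (measurable_preimage_iter mg 1).
  exact: measurable_visited.
- by apply: measurableI => //; exact: measurable_returned.
move=> x [Jx /visitedP[j jL]]; rewrite -iterSr => Jgx; split => //.
apply/returnedP; exists j => //; move: Jx Jgx.
rewrite /window /returns/= !in_itv/= ler_norml.
by move=> /andP[? ?] /andP[? ?]; apply/andP; split; lra.
Qed.

(** Sum of the estimates for the single cells.  Only the errors made in decoupling the
    cells are multiplied by their number; the others carry the mass of the cell or sum
    up to the probability of one event. *)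
Lemma nreturns_poisson :
  `|P [set x | nreturns r n x = k] - \int[mu]_x h x| <=
    P (~` `[b, b + N%:R * w[%classic) + P (returned (2 * r) L)
    + N%:R * (n.+1%:R * theta) + (8 * n%:R * w * D + 2 * L%:R * r * D
    + n%:R * (2 * ((2 * r + w) * D * P (returned (2 * r) L) + theta
        + L%:R * (2 * r * D) ^+ 2) + 2 * (2 * r * D) ^+ 2)).
Proof.
have mR : measurable [set x | nreturns r n x = k] by exact: measurable_nreturns.
have mUC : measurable (~` U N) by exact: measurableC.
have h01 x : 0 <= h x <= 1.
  by rewrite pois_ge0 ?pois_le1// mulr_ge0// pr_ge0.
rewrite -(setvU (U N)) (@Rintegral_setU _ _ _ mu _ _ _ mUC (mU N)); last 2 first.
- by apply: ih; exact: (measurableU _ _ mUC (mU N)).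
- by apply/disj_setPS; rewrite setICl.
rewrite -[X in P X](setTI) -{1}(setvU (U N)) setIUl pr_disjointU; last 3 first.
- exact: (measurableI _ _ mUC mR).
- exact: (measurableI _ _ (mU N) mR).
- by rewrite setIACA setICl set0I.
rewrite -/(U N) -Rintegral_cells -pr_cells//.
set A := P (~` _ `&` _); set H := Rintegral _ _ _.
have hA : `|A - H| <= P (~` U N).
  have A0 : 0 <= A <= P (~` U N).
    by rewrite pr_ge0 le_pr//; exact: measurableI.
  have H0 : 0 <= H <= P (~` U N).
    rewrite Rintegral_ge0; last by move=> x _; have /andP[] := h01 x.
    rewrite -[leRHS]mul1r /pr -(Rintegral_cst mu mUC) le_Rintegral//.
    + exact: ih.
    + exact: finite_measure_integrable_cst.
    + by move=> x _; have /andP[] := h01 x.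
  by rewrite ler_norml; apply/andP; split; lra.
rewrite (_ : forall s t : R, A + s - (H + t) = (A - H) + (s - t)); last by move=> *; ring.
apply: le_trans (ler_normD _ _) _; rewrite -!addrA lerD//.
rewrite -sumrB; apply: le_trans (ler_norm_sum _ _ _) _.
have e i := cell_poisson n k r_ge0 w_ge0 (short_return i).
apply: le_trans (ler_sum _ (fun (i : 'I_N) _ => e i)) _.
rewrite 2!big_split/= sumr_const card_ord -[X in _ + X + _]mulr_natl.
rewrite -[leLHS]addrA lerD//.
  rewrite pr_cells; last exact: measurable_returned.
  apply: le_pr; [|exact: measurable_returned|].
    exact: (measurableI _ _ (mU N) (measurable_returned r L)).
  move=> x [_ /returnedP[i iL xi]]; apply/returnedP; exists i => //.
  by move: xi; rewrite /returns/= => /le_trans; apply; rewrite ler_peMl// ler1n.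
rewrite lerD2l.
pose c1 := 8 * n%:R * w * D + 2 * L%:R * r * D
    + n%:R * (2 * (theta + L%:R * (2 * r * D) ^+ 2) + 2 * (2 * r * D) ^+ 2).
have c1_ge0 : 0 <= c1.
  by rewrite /c1 !(addr_ge0, mulr_ge0)// exprn_ge0// !mulr_ge0.
rewrite (eq_bigr (fun i : 'I_N => P (cell w (corner i)) * c1 + 2 * n%:R *
  (P (cell w (corner i)) * P (window r (corner i) `&` returned (2 * r) L)))); last first.
  by move=> i _; rewrite /c1; ring.
rewrite big_split/= -mulr_suml -mulr_sumr.
have : (\sum_(i < N) P (cell w (corner i))) * c1 <= c1.
  rewrite ler_piMl// (eq_bigr (fun i : 'I_N => P (cell w (corner i) `&` setT))).
    by rewrite pr_cells// pr_le1//; exact: (measurableI _ _ (mU N) measurableT).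
  by move=> i _; rewrite setIT.
have n2 : 0 <= 2 * n%:R :> R by rewrite mulr_ge0.
have := ler_wpM2l n2 (overlap (measurable_returned (2 * r) L)).
rewrite /c1; lra.
Qed.

End all_cells.
End returns_in_cells.

(** * The logarithmic time scale *)

Section logarithmic_scale.
Context {R : realType}.

Lemma ln_nat_cvgy : ln n%:R @[n --> \oo] --> (+oo : set_system R).
Proof.
apply/cvgryPge => A; near=> n.
rewrite -[A]expRK ler_ln ?posrE ?expR_gt0 ?ltr0n//; last by near: n; exists 1%N.
by near: n; exact: nbhs_infty_ger.
Unshelve. all: by end_near. Qed.

Lemma expR_ln_cvg0 (c : R) : 0 < c -> expR (- (c * ln n%:R)) @[n --> \oo] --> (0 : R).
Proof.
move=> c0; have /cvg_pinftyP := @cvgr_expR R; apply.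
apply/cvgryPge => A; near=> n; rewrite -ler_pdivrMl//.
by near: n; move/cvgryPge : ln_nat_cvgy; exact.
Unshelve. all: by end_near. Qed.

Lemma ln2_expR_ln_cvg0 (c : R) : 0 < c ->
  ln n%:R ^+ 2 * expR (- (c * ln n%:R)) @[n --> \oo] --> (0 : R).
Proof.
move=> c0; have b0 : 0 < c / 4 by rewrite divr_gt0.
apply: (@squeeze_cvgr _ _ _ _ (cst 0)
    (fun n => (c / 4) ^- 2 * expR (- (c / 2 * ln n%:R)))); last 2 first.
- exact: cvg_cst.
- rewrite -(mulr0 ((c / 4) ^- 2)); apply: cvgM; first exact: cvg_cst.
  by apply: expR_ln_cvg0; rewrite divr_gt0.
near=> n; rewrite mulr_ge0 ?sqr_ge0 ?expR_ge0//=.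
set u := ln n%:R; have u0 : 0 <= u by apply: ln_ge0; rewrite ler1n; near: n; exists 1%N.
(* Half of the exponential absorbs the square: u^2 is at most a constant times
   exp (c u / 2), by squaring the inequality below. *)
have h : c / 4 * u <= expR (c / 4 * u).
  by apply: le_trans (expR_ge1Dx _); rewrite lerDr.
have h2 : (c / 4 * u) ^+ 2 <= expR (c / 2 * u).
  apply: (@le_trans _ _ (expR (c / 4 * u) ^+ 2)).
    by rewrite lerXn2r// nnegrE ?expR_ge0// mulr_ge0// ltW.
  by rewrite expr2 -expRD -mulrDl (_ : c / 4 + c / 4 = c / 2)//; field.
have -> : - (c * u) = - (c / 2 * u) - (c / 2 * u) by field.
rewrite expRD mulrA ler_wpM2r ?expR_ge0// expRN ler_pdivrMr ?expR_gt0//.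
by rewrite ler_pdivlMl ?exprn_gt0// -exprMn.
Unshelve. all: by end_near. Qed.

Lemma pow4_expR_ln2_cvg0 (c : R) : 0 < c ->
  n%:R ^+ 4 * expR (- (c * ln n%:R ^+ 2)) @[n --> \oo] --> (0 : R).
Proof.
move=> c0; apply: (@squeeze_cvgr _ _ _ _ (cst 0) (fun n => expR (- (1 * ln n%:R)))); last 2 first.
- exact: cvg_cst.
- exact: expR_ln_cvg0.
near=> n; rewrite mulr_ge0 ?exprn_ge0 ?expR_ge0//=.
have n0 : 0 < n%:R :> R by rewrite ltr0n; near: n; exists 1%N.
rewrite -[X in X ^+ 4](lnK n0) -expRM_natl -expRD ler_expR mul1r.
(* Once c u >= 5, the exponent 4 u - c u^2 is at most - u. *)
have u5 : 5 / c <= ln n%:R.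
  by near: n; move/cvgryPge : ln_nat_cvgy; exact.
move: u5; set u := ln n%:R => u5.
have : c * u >= 5 by rewrite mulrC -ler_pdivrMr.
have u0 : 0 <= u by rewrite (le_trans _ u5)// divr_ge0// ltW.
nra.
Unshelve. all: by end_near. Qed.

End logarithmic_scale.

(** * Interval systems as systems on the line *)

Section bounded_variation.
Context {R : realType}.
Implicit Types (X I : set R).

(** An interval is the difference of two down-sets, and the indicator of a down-set is
    monotone, so that its variation is at most 1. *)
Lemma variation_indic_interval I (a b : R) (s : seq R) : is_interval I ->
  itv_partition a b s -> variation a b (\1_I : R -> R) s <= 2.
Proof.
move=> iI abs.
pose A := [set x | exists2 y, I y & x <= y].
have variation_down B : (forall x y : R, x <= y -> B y -> B x) ->
    variation a b (\1_B : R -> R) s <= 1.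
  move=> hB; rewrite nonincreasing_variation//.
    move=> y x _ _ yx; rewrite !indicE.
    have [Bx|Bx] := pselect (B x); last by rewrite (memNset Bx).
    by rewrite (mem_set Bx) (mem_set (hB _ _ yx Bx)).
have -> : \1_I = (\1_A : R -> R) \+ (\- (\1_(A `\` I) : R -> R)).
  apply/funext => x /=; rewrite !indicE in_setD.
  have [Ix|Ix] := pselect (I x).
    by rewrite !mem_set ?subr0//; exists x.
  by rewrite (memNset Ix) andbT subrr.
apply: le_trans (variation_le _ _ _ _ _) _; rewrite variationN.
apply: lerD; apply: variation_down => x y xy.
- by move=> [z Iz yz]; exists z => //; exact: le_trans yz.
- move=> [[z Iz yz] Iy]; split; first by exists z => //; exact: le_trans yz.
  by move=> Ix; apply: Iy; apply: (iI _ _ Ix Iz); rewrite xy yz.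
Qed.

Lemma bv_norm_indic_interval X I : is_interval I ->
  (bv_norm X (\1_I : R -> R) <= 3%:E)%E.
Proof.
move=> iI; rewrite (_ : 3%:E = 2%:E + 1%:E)%E; last by rewrite -EFinD; congr EFin; ring.
apply: leeD; apply: ge_ereal_sup => v.
  by move=> [a [b [s [_ _ abs ->]]]]; rewrite lee_fin variation_indic_interval.
by move=> [x _ <-]; rewrite lee_fin indicE; case: (_ \in I); rewrite ?normr1 ?normr0.
Qed.

Lemma BV_bounded X phi : X !=set0 -> BV_on X phi ->
  exists2 D : R, 0 <= D & forall x, X x -> `|phi x| <= D.
Proof.
move=> [x0 X0] bv.
have var0 : (0 <= var_on X phi)%E.
  apply: ereal_sup_ubound; exists x0, x0, [::]; split => //.
  by rewrite variation_nil.
have h : (sup_norm_on X phi < +oo)%E.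
  by apply: le_lt_trans bv; rewrite /bv_norm leeDr.
have ub x : X x -> (`|phi x|%:E <= sup_norm_on X phi)%E.
  by move=> Xx; apply: ereal_sup_ubound; exists x.
have s0 : (0 <= sup_norm_on X phi)%E by apply: le_trans (ub _ X0); rewrite lee_fin.
have sE : sup_norm_on X phi = (fine (sup_norm_on X phi))%:E.
  by rewrite fineK// ge0_fin_numE.
exists (fine (sup_norm_on X phi)); first exact: fine_ge0.
by move=> x /ub; rewrite sE lee_fin.
Qed.

End bounded_variation.

Section extension_to_the_line.
Context (R : realType) (X : set R) (f : R -> R)
  (mu : probability (measurableTypeR R) R) (rho : R -> R).
Hypothesis sys : acip_system X f mu rho.
Local Notation P := (pr mu).

(** Completing the map by the identity outside the phase space makes it measurable and
    measure preserving on the whole line, where all events can then be taken. *)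
Definition extension (x : R) : R := if x \in X then f x else x.
Local Notation g := extension.

Lemma measurable_phase_space : measurable X.
Proof. by apply: is_interval_measurable; have [] := sys. Qed.

Lemma extensionE x : X x -> g x = f x.
Proof. by move=> Xx; rewrite /extension mem_set. Qed.

Lemma iter_extension j x : X x -> X (iter j g x) /\ iter j g x = iter j f x.
Proof.
move=> Xx; elim: j => // j [IH1 IH2]; rewrite !iterS extensionE// IH2.
by split => //; rewrite -IH2; apply: (acip_maps sys).
Qed.

Lemma measurable_extension : measurable_fun setT g.
Proof.
have mX := measurable_phase_space.
move=> _ A mA; rewrite setTI.
have -> : g @^-1` A = (X `&` f @^-1` A) `|` (~` X `&` A).
  apply/seteqP; split => x /=; rewrite /extension.
    by have [Xx|Xx] := pselect (X x); [rewrite mem_set//; left|rewrite memNset//; right].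
  by case=> -[Xx]; [rewrite mem_set|rewrite memNset].
apply: measurableU; last by apply: measurableI => //; exact: measurableC.
by apply: (acip_measurable sys).
Qed.

Lemma measure_phase_space A : measurable A -> mu (A `&` X) = mu A.
Proof.
move=> mA; have mX := measurable_phase_space.
have h : mu (A `\` X) = 0%E.
  apply/eqP; rewrite -measure_le0; apply: (@le_trans _ _ (mu (~` X))).
    by apply: le_measure; rewrite ?inE; [exact: measurableD|exact: measurableC|move=> x []].
  by rewrite probability_setC// (acip_full sys) subee.
have := measureDI mu mA mX; rewrite [X in (X + _)%E]h add0e => ->.
by [].
Qed.

Lemma extension_invariant A : measurable A -> mu (g @^-1` A) = mu A.
Proof.
move=> mA; have mX := measurable_phase_space.
rewrite -measure_phase_space; last first.
  by rewrite -[X in measurable X]setTI; apply: measurable_extension.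
rewrite -(acip_invariant sys mA); congr (mu _); apply/seteqP; split => x /=.
  by move=> [+ Xx]; rewrite extensionE.
by move=> [Xx]; rewrite extensionE.
Qed.

Lemma nonempty_phase_space : X !=set0.
Proof.
apply/set0P/eqP => X0; have := acip_full sys.
by rewrite X0 measure0 => /eqP; rewrite eqe eq_sym oner_eq0.
Qed.

Lemma pr_itv_le D a b : (forall x, X x -> rho x <= D) -> 0 <= D -> a <= b ->
  P `[a, b] <= D * (b - a).
Proof.
move=> rhoD D0 ab; have mX := measurable_phase_space.
have [mrho rho0 muE] := acip_density sys.
have mI : measurable (`[a, b]%classic `&` X) by apply: measurableI.
rewrite -lee_fin -prE// -measure_phase_space// (muE _ mI (@subIsetr _ _ _)).
apply: (@le_trans _ _ (\int[lebesgue_measure]_(x in `[a, b]%classic `&` X) D%:E)%E).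
  apply: ge0_le_integral => //.
  - by move=> x [_ /rho0 ?]; rewrite lee_fin.
  - by apply/measurable_EFinP; exact: (measurable_funS mX (@subIsetr _ _ _) mrho).
  - by move=> x [_ /rhoD]; rewrite lee_fin.
rewrite integral_cst// EFinM lee_wpmul2l ?lee_fin//.
apply: (@le_trans _ _ (lebesgue_measure `[a, b]%classic)).
  by rewrite le_measure ?inE//; exact: subIsetl.
rewrite lebesgue_measure_itv/= lte_fin; case: ifP => //.
by rewrite lee_fin subr_ge0.
Qed.

(** Decay of correlations for indicators: the one of [I] has norm at most 3, the one of
    [A] has [L1] norm at most 1. *)
Lemma interval_decorrelation : decay_of_correlations X f mu ->
  exists C0 c0 : R, [/\ 0 < C0, 0 < c0 & forall (I : set R) j A, is_interval I ->
    measurable A -> `|P (I `&` iter j g @^-1` A) - P I * P A| <= C0 * expR (- (c0 * j%:R))].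
Proof.
move=> [C0 [c0 [C00 c00 decay]]]; exists (3 * C0), c0; split=> [||I j A iI mA] //.
  by rewrite mulr_gt0.
have mX := measurable_phase_space.
have mI : measurable I by exact: is_interval_measurable.
have mgA : measurable (iter j g @^-1` A).
  by apply: measurable_preimage_iter => //; exact: measurable_extension.
have BVI : BV_on X (\1_I : R -> R).
  by apply: le_lt_trans (bv_norm_indic_interval X iI) _; rewrite ltry.
have intA : mu.-integrable X (EFin \o (\1_A : R -> R)).
  by apply: (@integrable_pr _ _ _ mu _ _ 1) => // x; rewrite indicE;
    case: (_ \in A); rewrite ?lexx ?ler01.
have indicX B : measurable B -> (\int[mu]_(x in X) (\1_B x)%:E)%E = (P B)%:E.
  by move=> mB; rewrite integral_indic//; exact: etrans (measure_phase_space mB) (prE _ mB).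
have joint : (\int[mu]_(x in X) ((\1_I x : R) * \1_A (iter j f x))%:E)%E =
    (P (I `&` iter j g @^-1` A))%:E.
  rewrite -(indicX _ (measurableI _ _ mI mgA)); apply: eq_integral => x /set_mem Xx.
  by rewrite indicI /= -(iter_extension j Xx).2 !indicE.
have := decay (\1_I) (\1_A) BVI intA j.
rewrite joint !indicX//.
have -> : L1_norm X mu (\1_A) = (P A)%:E.
  by rewrite -indicX//; apply: eq_integral => x _; rewrite ger0_norm.
rewrite -EFinM -EFinB abse_EFin => h; rewrite -lee_fin; apply: le_trans h _.
have K0 : (0 <= (C0 * expR (- c0 * j%:R))%:E)%E by rewrite lee_fin mulr_ge0 ?expR_ge0// ltW.
apply: (@le_trans _ _ ((C0 * expR (- c0 * j%:R))%:E * bv_norm X (\1_I : R -> R))%E).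
  rewrite -[leRHS]mule1 lee_wpmul2l ?lee_fin ?pr_le1//.
  rewrite mule_ge0// /bv_norm adde_ge0//.
    have [x Xx] := nonempty_phase_space; apply: ereal_sup_ubound.
    by exists x, x, [::]; split => //; rewrite variation_nil.
  have [x Xx] := nonempty_phase_space.
  apply: (@le_trans _ _ `|\1_I x|%:E); first by rewrite lee_fin.
  by apply: ereal_sup_ubound; exists x.
apply: le_trans (lee_wpmul2l K0 (bv_norm_indic_interval X iI)) _.
by rewrite -EFinM lee_fin mulNr; lra.
Qed.

End extension_to_the_line.

(** * Measures with a density on the line *)

Section density_on_the_line.
Context (R : realType) (mu : probability (measurableTypeR R) R) (q : R -> R).
Local Notation leb := (@lebesgue_measure R).
Local Notation P := (pr mu).
Hypothesis mq : measurable_fun setT q.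
Hypothesis q_ge0 : forall x, 0 <= q x.
Hypothesis muE : forall A : set R, measurable A ->
  mu A = (\int[leb]_(x in A) (q x)%:E)%E.

Let integrable_q : leb.-integrable setT (EFin \o q).
Proof.
apply/integrableP; split; first exact/measurable_EFinP.
under eq_integral do rewrite /= ger0_norm//.
by rewrite -muE// probability_setT ltry.
Qed.

Let locally_integrable_q : locally_integrable setT q.
Proof.
have := integrable_locally measurableT integrable_q.
by rewrite patch_setT.
Qed.

Lemma density_dominates : mu `<< leb.
Proof.
apply/null_content_dominatesP => A mA A0.
by rewrite muE//; apply: null_set_integral => //; exact/measurable_EFinP/measurable_funTS.
Qed.

(** Both [q] and the Radon-Nikodym derivative integrate to [mu], so they agree almost
    everywhere. *)
Lemma integral_density (h : R -> R) c : measurable_fun setT h -> (forall x, 0 <= h x <= c) ->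
  (\int[mu]_x (h x)%:E = \int[leb]_x (h x * q x)%:E)%E.
Proof.
move=> mh hc.
have ih : mu.-integrable setT (EFin \o h).
  exact: (@integrable_pr _ _ _ mu h setT c measurableT mh hc).
rewrite -(Radon_Nikodym_change_of_variables density_dominates measurableT ih).
apply: ae_eq_integral => //.
- have RN := @Radon_Nikodym_integrable _ _ _ (charge_of_finite_measure mu) leb density_dominates.
  apply: emeasurable_funM; first exact/measurable_EFinP.
  by case/integrableP : RN.
- by apply/measurable_EFinP; exact: measurable_funM.
rewrite (_ : (fun x => (h x * q x)%:E) = ((EFin \o h) \* (EFin \o q))%E)//.
apply: ae_eqe_mul2l; apply: integral_ae_eq => //.
- exact: (@Radon_Nikodym_integrable _ _ _ (charge_of_finite_measure mu) leb density_dominates).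
- exact/measurable_EFinP.
move=> A _ mA.
rewrite -(@Radon_Nikodym_integral _ _ _ (charge_of_finite_measure mu) leb _ density_dominates mA).
exact: muE.
Qed.

(** The Lebesgue differentiation theorem along the balls of radius [tau / (2 n)]; the
    index is shifted by one to keep the radii finite and positive. *)
Lemma cvg_pr_window (tau : R) : 0 < tau ->
  {ae leb, forall x, n%:R * P (window (tau / (2 * n%:R)) x) @[n --> \oo] --> tau * q x}.
Proof.
move=> tau0.
pose r n : R := tau / (2 * n.+1%:R).
have r0 n : 0 < r n by rewrite divr_gt0// mulr_gt0.
have r20 n : 0 < 2 * r n by rewrite mulr_gt0.
have lebE x n : leb (window (r n) x) = (2 * r n)%:E.
  rewrite /window lebesgue_measure_itv/= lte_fin.
  rewrite ifT; first by rewrite -EFinB; congr EFin; ring.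
  by have := r0 n; lra.
have nice x : nicely_shrinking x (fun n => window (r n) x).
  split; first by move=> n; exact: measurable_itv.
  exists (2, fun n => PosNum (r20 n)); split => //=.
  - rewrite (_ : (fun n => _) = (fun n => tau * harmonic n)).
      by rewrite -(mulr0 tau); apply: cvgM; [exact: cvg_cst|exact: cvg_harmonic].
    by apply/funext => n; rewrite /r /harmonic/=; field; rewrite -(natrD _ 1) pnatr_eq0.
  - move=> n y; rewrite /window/= in_itv/= /ball/= => /andP[h1 h2].
    by have := r0 n; rewrite ltr_norml => ?; apply/andP; split; lra.
  - move=> n; rewrite (lebesgue_measure_ball _ (ltW (r20 n))) lebE -EFinM lee_fin.
    by rewrite mulr2n; lra.
have := lebesgue_differentiation locally_integrable_q.
apply: filterS; first exact: (ae_filter_ringOfSetsType leb).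
move=> x /(nice_lebesgue_differentiation nice locally_integrable_q) h.
rewrite -cvg_shiftS/=.
have : (fun n => (leb (window (r n) x))^-1 * \int[leb]_(y in window (r n) x) (q y)%:E)%E =
    (fun n => ((tau^-1 * (n.+1%:R * P (window (r n) x)))%:E)).
  apply/funext => n; rewrite -muE; last exact: measurable_itv.
  rewrite lebE inver gt_eqF// prE; last exact: measurable_itv.
  rewrite -EFinM; congr EFin; rewrite /r; field.
  by rewrite -(natrD _ 1) pnatr_eq0 gt_eqF.
move=> E; rewrite E in h; move/fine_cvgP : h => [_ h].
rewrite (_ : (fun n => n.+1%:R * _) = fun n => tau * (tau^-1 * (n.+1%:R * P (window (r n) x)))).
  by apply: cvgM; [exact: cvg_cst|exact: h].
by apply/funext => n; rewrite mulrA mulfV ?gt_eqF// mul1r.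
Qed.

End density_on_the_line.

(** * The limit law *)

Section limit_law.
Context (R : realType) (X : set R) (f : R -> R)
  (mu : probability (measurableTypeR R) R) (rho : R -> R).
Hypothesis hsys : hyperbolic_recurrent X f mu rho.
Local Notation P := (pr mu).
Local Notation g := (extension X f).
Local Notation leb := (@lebesgue_measure R).
Let sys : acip_system X f mu rho := hr_acip hsys.
Let mX : measurable X := measurable_phase_space sys.
Let mg : measurable_fun setT g := measurable_extension sys.
Let g_inv := extension_invariant sys.

Let q : R -> R := rho \_ X.

Let mq : measurable_fun setT q.
Proof.
by have [mrho _ _] := acip_density sys; exact: (measurable_restrictT rho mX).1 mrho.
Qed.

Let q_ge0 x : 0 <= q x.
Proof.
rewrite /q patchE; case: ifPn => // /set_mem Xx.
by have [_ + _] := acip_density sys; apply.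
Qed.

Let muE (A : set R) : measurable A -> mu A = (\int[leb]_(x in A) (q x)%:E)%E.
Proof.
move=> mA; have [_ _ E] := acip_density sys.
have mAX : measurable (A `&` X) by exact: measurableI.
rewrite -(measure_phase_space sys mA) (E _ mAX (@subIsetr _ _ _)) integral_mkcondr.
by apply: eq_integral => x _; rewrite /q !patchE; case: ifP.
Qed.

Let measurable_pois k : measurable_fun setT (@pois R k).
Proof.
apply: continuous_measurable_fun => x.
apply: differentiable_continuous; apply/derivable1_diffP.
by have [] := is_derive_pois k x.
Qed.

Let density_bound : exists2 D : R, 0 <= D & forall a b, a <= b -> P `[a, b] <= D * (b - a).
Proof.
have [D D0 hD] := BV_bounded (nonempty_phase_space sys) (hr_density_BV hsys).
exists D => // a b; apply: (pr_itv_le sys) => // x Xx.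
exact: le_trans (ler_norm _) (hD _ Xx).
Qed.

Lemma cvg_integral_pois_window (tau : R) k : 0 < tau ->
  (\int[mu]_x (pois k (n%:R * P (window (tau / (2 * n%:R)) x)))%:E)%E @[n --> \oo] -->
  (\int[leb]_(x in X) (tau ^+ k * rho x ^+ k.+1 / k`!%:R * expR (- (rho x * tau)))%:E)%E.
Proof.
move=> tau0; have [D D0 hD] := density_bound.
have P0 n r x : 0 <= n%:R * P (window r x) by rewrite mulr_ge0// pr_ge0.
have mh : measurable_fun setT (fun x => pois k (tau * q x)).
  by apply: measurableT_comp; [exact: measurable_pois|exact: measurable_funM].
have h01 x : 0 <= pois k (tau * q x) <= 1.
  by rewrite pois_ge0 ?pois_le1// mulr_ge0// ltW.
rewrite [X in _ --> X](_ : _ = \int[mu]_x (pois k (tau * q x))%:E)%E.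
  have [] := @dominated_convergence _ _ _ mu setT measurableT
    (fun n x => (pois k (n%:R * P (window (tau / (2 * n%:R)) x)))%:E)
    (fun x => (pois k (tau * q x))%:E) (cst 1%:E) => //.
  - move=> n; apply/measurable_EFinP; exact: (measurable_pois_window D0 hD).
  - exact/measurable_EFinP.
  - have [N [mN N0 hN]] := cvg_pr_window mq q_ge0 muE tau0.
    exists N; split => //.
      by apply: (null_content_dominatesP _ _).1 N0 => //; exact: (density_dominates mq muE).
    move=> x /= nx; apply: hN => /= cx; apply: nx => _.
    apply: cvg_EFin; first exact: nearW.
    apply: continuous_cvg cx.
    apply: differentiable_continuous; apply/derivable1_diffP.
    by have [] := is_derive_pois k (tau * q x).
  - exact: finite_measure_integrable_cst.
  - apply: aeW => x n _ /=; rewrite lee_fin ger0_norm ?pois_ge0//; exact: pois_le1.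
rewrite (integral_density mq muE mh h01) [LHS]integral_mkcond.
apply: eq_integral => x _; rewrite /q !patchE; case: ifP => _; last by rewrite mulr0.
by congr EFin; rewrite /pois exprMn exprS [tau * _]mulrC; ring.
Qed.
(** The waiting time: long enough for [exp (- c L)] to beat every power of [n], and the
    longest one for which short returns are controlled. *)
Let L n := Num.truncn (ln n%:R ^+ 2 : R).

Let L_le n : (L n)%:R <= ln n%:R ^+ 2 :> R.
Proof. by rewrite truncn_le sqr_ge0. Qed.

Let L_gt n j : (L n < j)%N -> ln n%:R ^+ 2 <= j%:R :> R.
Proof.
move=> Lj; have /andP[_ /ltW h] := truncn_itv (sqr_ge0 (ln n%:R : R)).
by apply: le_trans h _; rewrite ler_nat.
Qed.

Lemma comparable_power_inv (tau : R) : 0 < tau ->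
  comparable_power (fun n => tau / n%:R) 1.
Proof.
move=> tau0; have tV0 : 0 < tau^-1 by rewrite invr_gt0.
exists (tau + tau^-1 + 1); first by rewrite ltrDr addr_gt0.
move=> n n0; rewrite powRN powRr1// invrK mulfVK ?pnatr_eq0 -?lt0n//.
apply/andP; split; last by lra.
by rewrite -[leRHS]invrK lef_pV2 ?posrE ?addr_gt0//; lra.
Qed.

(** The radius is that of quick returns to a window, [2 r = tau / n]. *)
Lemma pr_returned_le (tau : R) : 0 < tau ->
  exists beta C : R, [/\ 0 < beta, 0 < C & forall n, (0 < n)%N ->
    P (returned g (2 * (tau / (2 * n%:R))) (L n)) <=
      ln n%:R ^+ 2 * (C * (tau / n%:R) `^ beta)].
Proof.
move=> tau0; have [beta [C [/andP[beta0 _] C0 h]]] :=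
  hr_short_returns hsys (r := fun n => tau / n%:R) ltr01 (comparable_power_inv tau0).
exists beta, C; split=> // n n0.
have -> : 2 * (tau / (2 * n%:R)) = tau / n%:R.
  by field; rewrite pnatr_eq0 -lt0n.
set s := tau / n%:R; set K := C * _.
have K0 : 0 <= K by rewrite mulr_ge0 ?powR_ge0// ltW.
apply: le_trans (pr_bigsetU_le mu (F := fun i => returns g i.+1 s) _) _.
  by move=> i _; exact: measurable_returns.
apply: (@le_trans _ _ (\sum_(i < L n) K)); last first.
  by rewrite sumr_const card_ord -[leLHS]mulr_natl ler_wpM2r.
apply: ler_sum => i _; rewrite -lee_fin -prE; last exact: measurable_returns.
rewrite -(measure_phase_space sys); last exact: measurable_returns.
rewrite (_ : _ `&` X = return_set X f i.+1 s).
  apply: h => //; apply: le_trans (L_le n); rewrite ler_nat; exact: ltn_ord.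
apply/seteqP; split => x.
  move=> [h1 Xx]; split => //.
  by move: h1; rewrite /returns /mkset (iter_extension sys i.+1 Xx).2.
move=> [Xx h1]; split => //.
by rewrite /returns /mkset (iter_extension sys i.+1 Xx).2.
Qed.

(** The [2 n^3] cells of length [n^-2] starting at [- n] fill [[- n, n[]. *)
Lemma cvg_pr_outside : P (~` `[- n%:R, - n%:R + (2 * n ^ 3)%:R * n%:R ^- 2[%classic)
  @[n --> \oo] --> 0.
Proof.
pose F n : set R := `[- n%:R, n%:R[%classic.
have mF n : measurable (F n) by exact: measurable_itv.
have UF : \bigcup_n F n = setT.
  apply/seteqP; split => // x _; exists (Num.truncn `|x|).+1 => //.
  rewrite /F/= in_itv/=; have /andP[_] := truncn_itv (normr_ge0 x).
  by rewrite ltr_norml => /andP[/ltW -> ->].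
have h : (mu \o F) n @[n --> \oo] --> mu setT.
  rewrite -UF; apply: nondecreasing_cvg_mu => //; first by rewrite UF.
  move=> n m nm; apply/subsetPset => x; rewrite /F/= !in_itv/= => /andP[h1 h2].
  have : n%:R <= m%:R :> R by rewrite ler_nat.
  by move=> ?; apply/andP; split; lra.
rewrite probability_setT in h; move/fine_cvgP : h => [_ h].
have {h} : 1 - P (F n) @[n --> \oo] --> (1 - 1 : R) by apply: cvgB => //; exact: cvg_cst.
rewrite subrr; apply: cvg_trans; apply: near_eq_cvg; near=> n.
have n0 : n%:R != 0 :> R by rewrite pnatr_eq0 -lt0n; near: n; exists 1%N.
rewrite (_ : - n%:R + _ = n%:R); last by rewrite natrM natrX; field.
have := prIC mu (mF n) (@measurableT _ (measurableTypeR R)); rewrite !setIT => ->.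
by rewrite [pr mu setT]/pr probability_setT.
Unshelve. all: by end_near. Qed.

Lemma cvg_nreturns_poisson (tau : R) k : 0 < tau ->
  P [set x | nreturns g (tau / (2 * n%:R)) n x = k] -
  \int[mu]_x pois k (n%:R * P (window (tau / (2 * n%:R)) x)) @[n --> \oo] --> 0.
Proof.
move=> tau0; have [D D0 hD] := density_bound.
have [C0 [c0 [C00 c00 decor]]] := interval_decorrelation sys (hr_decay hsys).
have [beta [C [beta0 Cgt0 short]]] := pr_returned_le tau0.
(* T below is the bound of nreturns_poisson for cells of length n^-2, in terms of
   quantities that tend to 0: here v = 1 / n and l = (ln n)^2 / n, written with
   exponentials to match the limits computed above. *)
pose th n := C0 * expR (- (c0 * ln n%:R ^+ 2)).
pose s n := ln n%:R ^+ 2 * (C * (tau / n%:R) `^ beta).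
pose l n : R := ln n%:R ^+ 2 * expR (- (1 * ln n%:R)).
pose v n : R := expR (- (1 * ln n%:R)).
pose out n := P (~` `[- n%:R, - n%:R + (2 * n ^ 3)%:R * n%:R ^- 2[%classic).
pose T n := out n + (1 + 2 * (tau + 1) * D) * s n + 6 * (n%:R ^+ 4 * th n)
  + (8 * D + 2 * (tau * D) ^+ 2) * v n + (tau * D + 2 * (tau * D) ^+ 2) * l n.
have s0 : s n @[n --> \oo] --> 0.
  rewrite -(mulr0 (C * expR (beta * ln tau))).
  have : C * expR (beta * ln tau) * (ln n%:R ^+ 2 * expR (- (beta * ln n%:R)))
      @[n --> \oo] --> (C * expR (beta * ln tau) * 0 : R).
    by apply: cvgM; [exact: cvg_cst|exact: ln2_expR_ln_cvg0].
  apply: cvg_trans; apply: near_eq_cvg; near=> n.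
  have n0 : 0 < n%:R :> R by rewrite ltr0n; near: n; exists 1%N.
  rewrite /s /powR gt_eqF ?divr_gt0// ln_div ?posrE// mulrBr expRD.
  by ring.
have T0 : T n @[n --> \oo] --> 0.
  have cvgZ0 (c : R) u : u n @[n --> \oo] --> (0 : R) -> c * u n @[n --> \oo] --> (0 : R).
    by move=> u0; rewrite -(mulr0 c); apply: cvgM => //; exact: cvg_cst.
  have th_cvg : n%:R ^+ 4 * th n @[n --> \oo] --> 0.
    rewrite (_ : (fun n => _) = fun n => C0 * (n%:R ^+ 4 * expR (- (c0 * ln n%:R ^+ 2)))).
      by apply: cvgZ0; exact: pow4_expR_ln2_cvg0.
    by apply/funext => n; rewrite mulrCA.
  have := cvgD (cvgD (cvgD (cvgD cvg_pr_outside (cvgZ0 (1 + 2 * (tau + 1) * D) _ s0))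
    (cvgZ0 6 _ th_cvg)) (cvgZ0 (8 * D + 2 * (tau * D) ^+ 2) _ (expR_ln_cvg0 ltr01)))
    (cvgZ0 (tau * D + 2 * (tau * D) ^+ 2) _ (ln2_expR_ln_cvg0 ltr01)).
  by rewrite !addr0; exact.
apply/cvgr0Pnorm_le => eps eps0; near=> n.
have n0N : (0 < n)%N by near: n; exists 1%N.
have n0 : 0 < n%:R :> R by rewrite ltr0n.
have n1 : 1 <= n%:R :> R by rewrite ler1n.
have th0 m : 0 <= th m by rewrite mulr_ge0 ?expR_ge0// ltW.
have decor_n (I : set R) j A : is_interval I -> (L n < j)%N -> measurable A ->
    `|P (I `&` iter j g @^-1` A) - P I * P A| <= th n.
  move=> iI Lj mA; apply: le_trans (decor I j A iI mA) _.
  by rewrite ler_pM2l// ler_expR lerN2 ler_pM2l// L_gt.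
have r0 : 0 <= tau / (2 * n%:R) by rewrite divr_ge0 ?mulr_ge0// ltW.
have w0 : 0 <= n%:R ^- 2 :> R by rewrite invr_ge0 exprn_ge0.
apply: le_trans (nreturns_poisson mg g_inv D0 hD (th0 n) decor_n (- n%:R)
  (2 * n ^ 3) n k r0 w0) _.
apply: (@le_trans _ _ (T n)); last first.
  apply: le_trans (ler_norm _) _; near: n.
  by move/cvgr0Pnorm_le : T0; exact.
have vE : v n = n%:R^-1 by rewrite /v mul1r expRN lnK.
have lE : l n = ln n%:R ^+ 2 * n%:R^-1 by rewrite /l -/(v n) vE.
have := short n n0N; rewrite -/(s n) -/(out n).
move: (pr_ge0 mu (returned g (2 * (tau / (2 * n%:R))) (L n))).
set S := P (returned _ _ _) => S0 Ss.
have Ll := L_le n.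
have vv0 : 0 < n%:R^-1 :> R by rewrite invr_gt0.
have vv1 : n%:R^-1 <= 1 :> R by rewrite invf_le1.
have thn := th0 n.
rewrite /T vE lE; move: S0 Ss Ll vv0 vv1 thn n0 n1.
rewrite natrM natrX -[n.+1%:R]natr1.
move: (th n) (s n) (out n) => t s' o; set lam := ln _ ^+ 2; set l' := (L n)%:R.
set x := n%:R; move: lam l' x => lam l' x; clear -tau0 D0 => S0 Ss Ll v0 v1 t0 x0 x1.
have -> : o + S + 2 * x ^+ 3 * ((x + 1) * t) + (8 * x * x ^- 2 * D + 2 * l' * (tau / (2 * x)) * D
    + x * (2 * ((2 * (tau / (2 * x)) + x ^- 2) * D * S + t + l' * (2 * (tau / (2 * x)) * D) ^+ 2)
    + 2 * (2 * (tau / (2 * x)) * D) ^+ 2)) =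
  o + S + 2 * (x ^+ 3 * (x + 1) * t) + 8 * D * x^-1 + tau * D * (l' * x^-1)
    + 2 * ((tau + x^-1) * D * S) + 2 * (x * t) + 2 * (tau * D) ^+ 2 * (l' * x^-1)
    + 2 * (tau * D) ^+ 2 * x^-1.
  by field; rewrite gt_eqF.
have h1 : x ^+ 3 * (x + 1) * t <= 2 * (x ^+ 4 * t).
  have x3 : 0 <= x ^+ 3 by rewrite exprn_ge0// ltW.
  have x4 : 0 <= x - 1 by rewrite subr_ge0.
  by rewrite mulrA ler_wpM2r//; have := mulr_ge0 x3 x4; lra.
have h2 : l' * x^-1 <= lam * x^-1 by rewrite ler_wpM2r// ltW.
have h3 : (tau + x^-1) * D * S <= (tau + 1) * D * s'.
  apply: ler_pM => //; first by rewrite mulr_ge0// addr_ge0// ltW.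
  by rewrite ler_wpM2r// lerD2l.
have h4 : x * t <= x ^+ 4 * t by rewrite ler_wpM2r// ler_eXnr.
have h5 := ler_wpM2l (mulr_ge0 (ltW tau0) D0) h2.
have h6 := ler_wpM2l (sqr_ge0 (tau * D)) h2.
lra.
Unshelve. all: by end_near. Qed.

Lemma return_countE x n r : X x -> return_count f n r x = nreturns g r n x.
Proof.
move=> Xx; rewrite /return_count -sum1_count big_mkcond big_add1/= big_mkord.
apply: eq_bigr => i _; rewrite /return_dist -(iter_extension sys i.+1 Xx).2.
have -> : (x \in returns g i.+1 r) = (`|iter i.+1 g x - x| <= r).
  by apply/idP/idP; rewrite inE.
by case: ifP.
Qed.

Lemma measure_return_count n r k :
  mu [set x | X x /\ return_count f n r x = k] = (P [set x | nreturns g r n x = k])%:E.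
Proof.
have mN := measurable_nreturns mg r n k.
rewrite -prE// -(measure_phase_space sys mN); congr (mu _).
apply/seteqP; split => x /=; first by move=> [Xx <-]; rewrite return_countE.
by move=> [<- Xx]; rewrite return_countE.
Qed.

Lemma cvg_return_count (tau : R) k : 0 < tau ->
  mu [set x | X x /\ return_count f n (tau / (2 * n%:R)) x = k] @[n --> \oo] -->
  (\int[leb]_(x in X) (tau ^+ k * rho x ^+ k.+1 / k`!%:R * expR (- (rho x * tau)))%:E)%E.
Proof.
move=> tau0; have [D D0 hD] := density_bound.
have ih n r : mu.-integrable setT (EFin \o (fun x => pois k (n%:R * P (window r x)))).
  apply: (@integrable_pr _ _ _ mu _ setT 1) => //.
    exact: (measurable_pois_window D0 hD).
  by move=> x; rewrite pois_ge0 ?pois_le1// mulr_ge0// pr_ge0.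
(* The integral is kept in the extended reals, where its limit is known, and the
   error, which tends to 0, is added to it. *)
have E n : mu [set x | X x /\ return_count f n (tau / (2 * n%:R)) x = k] =
    (\int[mu]_x (pois k (n%:R * P (window (tau / (2 * n%:R)) x)))%:E +
     (P [set x | nreturns g (tau / (2 * n%:R)) n x = k] -
      \int[mu]_x pois k (n%:R * P (window (tau / (2 * n%:R)) x)))%:E)%E.
  rewrite measure_return_count -[X in (X + _)%E]fineK.
    by rewrite -EFinD; congr EFin; rewrite addrC subrK.
  exact: (integrable_fin_num measurableT (ih _ _)).
rewrite (funext E).
rewrite -[X in _ --> X]adde0; apply: cvgeD.
- by rewrite fin_num_adde_defl.
- exact: cvg_integral_pois_window.
- by apply: cvg_EFin; [exact: nearW|exact: cvg_nreturns_poisson].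
Qed.

End limit_law.

Unset Implicit Arguments.

Theorem theorem2p3 (R : realType) (X : set R) (f : R -> R)
    (mu : probability (measurableTypeR R) R) (rho : R -> R)
    (hsys : hyperbolic_recurrent X f mu rho)
    (tau : R) (tau_gt0 : 0 < tau) (k : nat) :
  (fun n : nat =>
     mu [set x | X x /\ return_count f n (tau / (2 * n%:R)) x = k]) @ \oo -->
  (\int[lebesgue_measure]_(x in X)
     (tau ^+ k * rho x ^+ k.+1 / k`!%:R * expR (- (rho x * tau)))%:E)%E.
Proof. exact: cvg_return_count. Qed.
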